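(* Let $K$ be the purely transcendental field extension of $F$ generated by the algebraically independent elements $\alpha_k,\beta_k$, $1\le k\le n$, and let $A=\bigotimes_{k=1}^n K[x_k,y_k : x_k^3=\alpha_k,\ y_k^3=\beta_k,\ y_kx_k=\rho x_ky_k]$ (tensor product over $K$). Then every Kummer subspace of $A$ has dimension at most $3n+1$ over $K$.
   Context: $n\ge 1$, and $F$ is an infinite field of characteristic not $3$ containing a primitive cube root of unity $\rho$. An element $x\in A$ is called Kummer if $x^3\in K$ and $x,x^2\notin K$. A $K$-vector subspace of $A$ is called Kummer if all its nonzero elements are Kummer. *)

(* Defs.v *)
From HB Require Import structures.
From mathcomp Require Import all_boot all_order all_algebra all_field.
From mathcomp Require Export mpoly.

Set Implicit Arguments.
Unset Strict Implicit.
Unset Printing Implicit Defensive.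

Import GRing.Theory.
Local Open Scope ring_scope.

Definition infinite_type (T : eqType) : Prop :=
  forall s : seq T, exists x : T, x \notin s.

(* F(alpha_1, ..., alpha_n, beta_1, ..., beta_n): the first n indeterminates
   are the alpha's, the last n are the beta's. *)
Definition ratfun (F : fieldType) (n : nat) : fieldType :=
  {fraction {mpoly F[n + n]}}.

Definition ratfun_const (F : fieldType) (n : nat) (c : F) : ratfun F n :=
  tofrac (c%:MP : {mpoly F[n + n]}).

Definition alpha (F : fieldType) (n : nat) (k : 'I_n) : ratfun F n :=
  tofrac ('X_(lshift n k) : {mpoly F[n + n]}).

Definition beta (F : fieldType) (n : nat) (k : 'I_n) : ratfun F n :=
  tofrac ('X_(rshift n k) : {mpoly F[n + n]}).

Definition symbol_relations (K : fieldType) (rho a b : K) (B : algType K)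
    (u v : B) : Prop :=
  [/\ u ^+ 3 = a%:A, v ^+ 3 = b%:A & v * u = rho *: (u * v)].

(* (S; x, y) is the K-algebra K[x, y : x^3 = a, y^3 = b, y x = rho x y], a
   presentation being expressed by its universal property. *)
Record is_symbol_algebra (K : fieldType) (rho a b : K) (S : algType K)
    (x y : S) : Prop := IsSymbolAlgebra {
  symbol_rel : symbol_relations rho a b x y;
  symbol_lift : forall (B : algType K) (u v : B),
    symbol_relations rho a b u v ->
    exists f : {lrmorphism S -> B}, f x = u /\ f y = v;
  symbol_lift_unique : forall (B : algType K) (f g : {lrmorphism S -> B}),
    f x = g x -> f y = g y -> f =1 g
}.

Definition commuting_images (K : fieldType) (I : finType)
    (S : I -> algType K) (B : algType K)
    (f : forall i, {lrmorphism S i -> B}) : Prop :=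
  forall i j, i != j -> forall (s : S i) (t : S j),
    f i s * f j t = f j t * f i s.

(* A, with the canonical maps s |-> 1 (x) ... (x) s (x) ... (x) 1, is the tensor
   product over K of the algebras S i: the universal target of families of
   algebra morphisms with pairwise commuting images. *)
Record is_tensor_product (K : fieldType) (I : finType) (S : I -> algType K)
    (A : algType K) (iota : forall i, {lrmorphism S i -> A}) : Prop :=
  IsTensorProduct {
  tensor_comm : commuting_images iota;
  tensor_lift : forall (B : algType K) (f : forall i, {lrmorphism S i -> B}),
    commuting_images f ->
    exists h : {lrmorphism A -> B}, forall i (s : S i), h (iota i s) = f i s;
  tensor_lift_unique : forall (B : algType K) (g h : {lrmorphism A -> B}),
    (forall i (s : S i), g (iota i s) = h (iota i s)) -> g =1 h
}.

Definition is_scalar (K : fieldType) (A : algType K) (z : A) : Prop :=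
  exists c : K, z = c%:A.

Definition kummer (K : fieldType) (A : algType K) (z : A) : Prop :=
  [/\ is_scalar (z ^+ 3), ~ is_scalar z & ~ is_scalar (z ^+ 2)].

Definition kummer_space (K : fieldType) (A : falgType K) (V : {vspace A})
  : Prop := forall v : A, v \in V -> v != 0 -> kummer v.

(* Main.v *)
Require Import Defs.
From HB Require Import structures.
From mathcomp Require Import all_boot all_order all_algebra all_field.
From mathcomp Require Import zify ring generic_quotient.

Set Implicit Arguments.
Unset Strict Implicit.
Unset Printing Implicit Defensive.

Import Order.TTheory GRing.Theory.
Local Open Scope ring_scope.

(** An algebra A as in the theorem is a quantum torus.  Its 2n generators Z_i
    (the x_k, then the y_k) commute up to powers of rho and have the
    indeterminates as cubes, so that the monomials Z^m, m in N^(2n), behave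
    like monomials of a polynomial ring: Z^m Z^m' is Z^(m + m') up to a power of
    rho, and Z^m Z^m' = rho^w(m, m') Z^m' Z^m for a nondegenerate alternating
    form w that depends only on the classes of m and m' in F_3^(2n).  Moreover
    Z^(3m) is the monomial of exponent m in the indeterminates; hence the Z^m
    are linearly independent over F, and up to a denominator every element of A
    is an F-combination of them.

    A monomial order on N^(2n) thus gives leading terms in A.  Two monomials
    are proportional over K only if their exponents agree modulo 3, so Gaussian
    elimination finds in a subspace V as many elements with leading exponents in
    distinct classes as its dimension (leading_classes).  This replaces V by a
    set T of dim V vectors of F_3^(2n).

    If the cubes of V are scalars, polarising shows that the symmetrised
    products uuv + uvu + vuu and the sum of the six products of u, v, w in all
    orders are scalars.  Comparing with the products of the leading terms: if
    a, b in T are distinct then w(a, b) <> 0, since otherwise the first sum has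
    the leading term 3uuv, which is not scalar as 2a + b <> 0
    (leading_classes_noncommuting); and if w(a, b) = w(b, c) = w(c, a) = 1, then
    the second sum has the leading term -3 rho uvw, so that a + b + c = 0
    (leading_classes_cyclic).

    The rest is combinatorics (card_triangle_condition).  Read w(a, b) = 1 as an
    arrow from a to b; then T is a tournament whose cyclic triangles have sum
    zero.  It follows that these triangles are pairwise disjoint.  Every vector
    outside a maximal transitive subtournament R closes a triangle with two
    vectors of R, so that 2 |T \ R| <= |R|.  The form has rank at least |R| - 1
    on R, so |R| <= 2n + 1, and |T| <= 2n + 1 + n.

    The universal properties enter only to show that the Z_i generate A
    (tensor_of_symbols_generated). *)

(** * Tournaments of an alternating form over F_3 *)

Lemma F3_cases (t : 'F_3) : [\/ t = 0, t = 1 | t = -1].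
Proof.
case: t => -[|[|[|]]] // i; [constructor 1|constructor 2|constructor 3];
  exact: val_inj.
Qed.

Section SkewForm.
Variables (N : nat) (J : 'M['F_3]_N).
Hypothesis J_skew : J^T = - J.
Implicit Types a b c v : 'rV['F_3]_N.

Definition skew_form a b : 'F_3 := (a *m J *m b^T) 0 0.
Local Notation w := skew_form.

Lemma skew_formDl a b c : w (a + b) c = w a c + w b c.
Proof. by rewrite /skew_form !mulmxDl mxE. Qed.

Lemma skew_formDr a b c : w a (b + c) = w a b + w a c.
Proof. by rewrite /skew_form linearD /= mulmxDr mxE. Qed.

Lemma skew_formNr a b : w a (- b) = - w a b.
Proof. by rewrite /skew_form linearN /= mulmxN mxE. Qed.

Lemma skew_formC a b : w a b = - w b a.
Proof.
rewrite /skew_form -[in LHS](trmxK (a *m J *m b^T)) [LHS]mxE !trmx_mul trmxK J_skew.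
by rewrite mulmxA mulmxN mulNmx mxE.
Qed.

Lemma skew_form_self a : w a a = 0.
Proof.
have := skew_formC a a.
by case: (F3_cases (w a a)) => -> // /eqP.
Qed.

(** With arrows from a to b when [w a b = 1], this is a transitive
    tournament listed in its order. *)
Definition chain : seq 'rV['F_3]_N -> bool := pairwise (fun a b => w a b == 1).

Lemma chain_uniq s : chain s -> uniq s.
Proof.
rewrite uniq_pairwise; apply: sub_pairwise => a b.
by apply: contraTneq => ->; rewrite skew_form_self.
Qed.

(** For a chain r_0, r_1, ..., r_m the numbers w(r_i, r_j - r_(j+1)) vanish for
    i < j and equal -1 for i = j.  So they form an invertible triangular matrix
    of size m, whose rank cannot exceed the dimension of the ambient space. *)
Lemma chain_size s : chain s -> (size s <= N.+1)%N.
Proof.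
case: s => // r0 s chs.
set m := size s.
pose r i := nth 0 (r0 :: s) i.
have r1 i j : (i < j <= m)%N -> w (r i) (r j) = 1.
  case/andP=> ij jm; apply/eqP.
  by apply: (pairwiseP 0 chs); rewrite ?inE //=; apply: leq_trans jm; apply: ltnW.
pose B : 'M['F_3]_(m, N) := \matrix_(i, k) r i 0 k.
pose D : 'M['F_3]_(m, N) := \matrix_(i, k) (r i - r i.+1) 0 k.
have GE i j : (B *m J *m D^T) i j = w (r i) (r j - r j.+1).
  rewrite /skew_form mxE [RHS]mxE; apply: eq_bigr => k _; rewrite !mxE.
  by congr (_ * _); apply: eq_bigr => l _; rewrite !mxE.
have Gdet : \det (B *m J *m D^T) != 0.
  rewrite det_trig; last first.
    apply/is_trig_mxP => i j ij.
    rewrite GE skew_formDr skew_formNr !r1 ?subrr //.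
      by rewrite ltnS (ltnW ij) ltn_ord.
    by rewrite ij ltnW.
  apply/prodf_neq0 => i _.
  by rewrite GE skew_formDr skew_formNr skew_form_self sub0r r1 // ltnSn /=.
have := mxrankM_maxl (B *m J) D^T.
rewrite mxrank_unit; last by rewrite unitmxE unitfE.
by move/leq_trans; apply; apply: rank_leq_col.
Qed.

Definition in_triangle (s : seq 'rV['F_3]_N) v :=
  exists a b, [/\ a \in s, b \in s, w a b = 1, w b v = 1 & w v a = 1].

(** The obstruction to inserting v in a chain is a pair a, b in this order such
    that v precedes a and follows b, that is, a cyclic triangle. *)
Lemma chain_insert s v :
    chain s -> (forall a, a \in s -> w a v != 0) ->
  (exists2 s', chain s' & s' =i v :: s) \/ in_triangle s v.
Proof.
elim: s => [|a s IHs] /=; first by left; exists [:: v].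
case/andP=> a_s ch_s nz.
have [|[s' ch_s' s'E]|[b [c [bs cs bc cv vb]]]] := IHs ch_s.
- by move=> b bs; apply: nz; rewrite inE bs orbT.
- have [/eqP|av|av] := F3_cases (w a v); first by rewrite (negPf (nz _ (mem_head _ _))).
    left; exists (a :: s').
      rewrite /= ch_s' andbT; apply/allP => b; rewrite s'E inE.
      by case/predU1P=> [->|/(allP a_s)//]; rewrite av.
    by move=> b; rewrite !inE s'E inE orbCA.
  have va : w v a = 1 by rewrite skew_formC av opprK.
  have [/allP all1|/allPn[b bs vb]] := boolP (all (fun b => w v b == 1) s).
    left; exists [:: v, a & s] => //=.
    by rewrite va eqxx a_s ch_s !andbT; apply/allP.
  right; exists a, b; rewrite !inE eqxx bs orbT; split=> //.
    by apply/eqP/(allP a_s).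
  have := nz b; rewrite inE bs orbT => /(_ isT).
  rewrite (skew_formC b v) oppr_eq0.
  by case: (F3_cases (w v b)) vb => -> // _ _; rewrite opprK.
- by right; exists b, c; rewrite !inE bs cs !orbT.
Qed.

(** The chain is built greedily: an element that cannot be inserted when its
    turn comes is in a triangle with the chain, and stays so when the chain
    grows. *)
Lemma maximal_chain (l : seq 'rV['F_3]_N) :
    {in l &, forall a b, a != b -> w a b != 0} ->
  exists s, [/\ chain s, {subset s <= l}
    & forall v, v \in l -> v \in s \/ in_triangle s v].
Proof.
elim: l => [|v l IHl] nz; first by exists [::].
have [|s [ch_s sl tri]] := IHl.
  by move=> a b al bl; apply: nz; rewrite inE ?al ?bl orbT.
have [vs|vs] := boolP (v \in s).
  exists s; split=> // [a /sl|a].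
    by rewrite inE orbC => ->.
  by case/predU1P=> [->|/tri//]; left.
have [a sa||] := @chain_insert s v ch_s.
- by apply: nz; rewrite ?inE ?eqxx ?(sl a) ?orbT //; apply: contraNneq vs => <-.
- case=> s' ch_s' s'E; exists s'; split=> // [a|a].
    by rewrite s'E !inE; case/predU1P=> [->|/sl->]; rewrite ?eqxx ?orbT.
  rewrite s'E !inE; case: eqP => [_ _|_ /tri] /=; first by left.
  case=> [->|[b [c [bs cs ? ? ?]]]]; [by left | right].
  by exists b, c; rewrite !s'E !inE bs cs !orbT.
- move=> vtri; exists s; split=> // [a /sl|a].
    by rewrite inE orbC => ->.
  by case/predU1P=> [->|/tri//]; right.
Qed.

Section CyclicTriangles.
Variable T : {set 'rV['F_3]_N}.
Hypothesis T_nz : {in T &, forall a b, a != b -> w a b != 0}.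
Hypothesis T_tri : forall a b c, a \in T -> b \in T -> c \in T ->
  w a b = 1 -> w b c = 1 -> w c a = 1 -> a + b + c = 0.

(** Let t be w(b, b').  As the triangles have sum zero, w(b, c') = 1 - t and
    w(b', c) = 1 + t.  If t is 1 or -1, one of them vanishes, so that b = c' or
    b' = c, but a has an arrow to b and b' and from c and c'.  Hence t = 0 and
    b = b'. *)
Lemma triangles_share_vertex a b c b' c' :
    a \in T -> b \in T -> c \in T -> b' \in T -> c' \in T ->
    w a b = 1 -> w b c = 1 -> w c a = 1 ->
    w a b' = 1 -> w b' c' = 1 -> w c' a = 1 ->
  b = b' /\ c = c'.
Proof.
move=> aT bT cT b'T c'T ab bc ca ab' b'c' c'a.
have := T_tri aT bT cT ab bc ca; move/eqP; rewrite addrC addr_eq0 => /eqP cE.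
have := T_tri aT b'T c'T ab' b'c' c'a; move/eqP; rewrite addrC addr_eq0 => /eqP c'E.
suff bb' : b = b' by rewrite cE c'E bb'.
apply/eqP/negPn/negP=> /(T_nz bT b'T).
have [->//|bb' _|bb' _] := F3_cases (w b b').
- have bc' : b = c'.
    apply/eqP/negPn/negP=> /(T_nz bT c'T).
    by rewrite c'E skew_formNr skew_formDr bb' skew_formC ab.
  by move: c'a; rewrite -bc' skew_formC ab.
- have b'c : b' = c.
    apply/eqP/negPn/negP=> /(T_nz b'T cT).
    rewrite cE skew_formNr skew_formDr (skew_formC b' b) bb'.
    by rewrite skew_formC ab'.
  by move: ca; rewrite -b'c skew_formC ab'.
Qed.

(** Let R be a maximal chain.  Each v in T outside R is in a triangle with two
    elements of R, and different v do not share these, because triangles with a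
    common vertex coincide and contain a single element outside R.  Thus
    2 |T \ R| <= |R|, while |R| <= N + 1. *)
Lemma card_triangle_condition : (#|T| <= N.+1 + N.+1./2)%N.
Proof.
have [|s [ch_s sT tri]] := @maximal_chain (enum T).
  by move=> a b; rewrite !mem_enum; apply: T_nz.
have {}sT a : a \in s -> a \in T by move/sT; rewrite mem_enum.
pose R := [set a in s].
have RT : R \subset T by apply/subsetP=> a; rewrite inE => /sT.
have cardR : (#|R| <= N.+1)%N.
  by rewrite cardsE (card_uniqP _) ?chain_uniq // chain_size.
pose tri1 v a := (a \in s) &&
  [exists b, [&& b \in s, w a b == 1, w b v == 1 & w v a == 1]].
pose f v := odflt 0 [pick a | tri1 v a].
pose g v := - (v + f v).
have fP v : v \in T :\: R ->
    [/\ f v \in s, g v \in s, w (f v) (g v) = 1, w (g v) v = 1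
      & w v (f v) = 1].
  rewrite !inE => /andP[vs vT]; rewrite /g /f.
  case: pickP => [a /andP[sa /existsP[b]]|] /=.
    case/and4P=> sb /eqP ab /eqP bv /eqP va.
    suff -> : - (v + a) = b by [].
    have /eqP := T_tri vT (sT _ sa) (sT _ sb) va ab bv.
    by rewrite addrC addr_eq0 => /eqP.
  have vE : v \in enum T by rewrite mem_enum.
  case: (tri v vE) => [|[a [b [sa sb ab bv va]]]]; first by rewrite (negPf vs).
  move/(_ a)/negP; case; rewrite /tri1 sa; apply/existsP; exists b.
  by rewrite sb ab bv va eqxx.
(* The two corners in R of the triangle of v, indexed by a boolean. *)
pose h (vb : 'rV['F_3]_N * bool) := if vb.2 then f vb.1 else g vb.1.
pose D := setX (T :\: R) [set: bool].
have hR : h @: D \subset R.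
  apply/subsetP=> _ /imsetP[[v []] /setXP[/= /fP[fs gs _ _ _] _] ->]; by rewrite inE.
have h_inj : {in D &, injective h}.
  move=> [v i] [v' i'] /setXP[/= vD _] /setXP[/= v'D _].
  have [fs gs fg gv vf] := fP v vD; have [fs' gs' fg' gv' vf'] := fP v' v'D.
  move: vD v'D; rewrite !inE => /andP[vs vT] /andP[v's v'T].
  rewrite /h /=; case: i; case: i' => E.
  - move: fg' gv' vf'; rewrite -E => fg' gv' vf'.
    have [_ vv'] :=
      triangles_share_vertex (sT _ fs) (sT _ gs) vT (sT _ gs') v'T
        fg gv vf fg' gv' vf'.
    by rewrite vv'.
  - move: fg' gv' vf'; rewrite -E => fg' gv' vf'.
    have [gE _] :=
      triangles_share_vertex (sT _ fs) (sT _ gs) vT v'T (sT _ fs')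
        fg gv vf gv' vf' fg'.
    by rewrite -gE gs in v's.
  - move: fg' gv' vf'; rewrite -E => fg' gv' vf'.
    have [vE _] :=
      triangles_share_vertex (sT _ gs) vT (sT _ fs) (sT _ gs') v'T
        gv vf fg fg' gv' vf'.
    by rewrite vE gs' in vs.
  - move: fg' gv' vf'; rewrite -E => fg' gv' vf'.
    have [vv' _] :=
      triangles_share_vertex (sT _ gs) vT (sT _ fs) v'T (sT _ fs')
        gv vf fg gv' vf' fg'.
    by rewrite vv'.
have hcard : (#|T :\: R| * 2 <= #|R|)%N.
  have -> : (#|T :\: R| * 2)%N = #|D| by rewrite cardsX cardsT card_bool.
  by rewrite -(card_in_imset h_inj) subset_leq_card.
have -> : #|T| = (#|R| + #|T :\: R|)%N by rewrite -(cardsID R T) (setIidPr RT).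
move: #|T :\: R| #|R| hcard cardR => t r; lia.
Qed.

End CyclicTriangles.
End SkewForm.

(** * Powers of a primitive cube root of unity *)
Section CubeRootCharacter.
Variables (R : fieldType) (r : R).
Hypothesis r_prim : 3.-primitive_root r.

Definition chi (t : 'F_3) : R := r ^+ t.

Lemma chi_nat n : chi n%:R = r ^+ n.
Proof. by rewrite /chi val_Fp_nat // expr_mod // prim_expr_order. Qed.

Lemma chi0 : chi 0 = 1. Proof. by []. Qed.

Lemma chi1 : chi 1 = r. Proof. by []. Qed.

Lemma chiD s t : chi (s + t) = chi s * chi t.
Proof. by rewrite -[s]natr_Zp -[t]natr_Zp -natrD !chi_nat exprD. Qed.

Lemma chi_neq0 t : chi t != 0.
Proof.
rewrite expf_neq0 //; apply/eqP => r0; have /eqP := prim_expr_order r_prim.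
by rewrite r0 expr0n eq_sym oner_eq0.
Qed.

Lemma chi_eq1 t : (chi t == 1) = (t == 0).
Proof. by rewrite -(prim_order_dvd r_prim) /dvdn modn_small. Qed.

Lemma sum_cube_roots : 1 + r + r ^+ 2 = 0.
Proof.
have r1 : r - 1 != 0 by rewrite subr_eq0 -[r]chi1 chi_eq1.
apply/(mulfI r1); rewrite mulr0.
by have /eqP := prim_expr_order r_prim; rewrite -subr_eq0 => /eqP<-; ring.
Qed.

(** In characteristic 3 the sum 1 + r + r^2 would be (r - 1)^2. *)
Lemma three_neq0 : 3%:R != 0 :> R.
Proof.
apply/eqP=> /eqP three0.
have /eqP := sum_cube_roots.
have -> : 1 + r + r ^+ 2 = (r - 1) ^+ 2 + 3%:R * r by ring.
rewrite (eqP three0) mul0r addr0 sqrf_eq0 subr_eq0.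
by rewrite -[r]chi1 chi_eq1.
Qed.

End CubeRootCharacter.

(** * Polarisation of the cube map *)
Section Polarisation.
Variables (K : fieldType) (A : falgType K).
Implicit Types x y z : A.

Lemma scalarD x y : is_scalar x -> is_scalar y -> is_scalar (x + y).
Proof. by case=> c -> [d ->]; exists (c + d); rewrite scalerDl. Qed.

Lemma scalarZ c x : is_scalar x -> is_scalar (c *: x).
Proof. by case=> d ->; exists (c * d); rewrite scalerA. Qed.

Lemma scalarB x y : is_scalar x -> is_scalar y -> is_scalar (x - y).
Proof. by move=> xs ys; rewrite -scaleN1r; apply/scalarD/scalarZ. Qed.

Definition sym2 x y := x * x * y + x * y * x + y * x * x.

Definition sym3 x y z :=
  x * y * z + y * z * x + z * x * y + y * x * z + x * z * y + z * y * x.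

Lemma cubeD x y : (x + y) ^+ 3 = x ^+ 3 + sym2 x y + sym2 y x + y ^+ 3.
Proof.
rewrite /sym2 !exprSr !expr0 !mul1r !mulrDr !mulrDl !addrA.
by rewrite [LHS](ACl (1*5*3*2*4*6*7*8)).
Qed.

Lemma sym2Dl x y z : sym2 (x + y) z = sym2 x z + sym2 y z + sym3 x y z.
Proof.
rewrite /sym2 /sym3 !mulrDr !mulrDl !addrA.
by rewrite [LHS](ACl (1*5*9*4*8*12*3*6*11*2*7*10)).
Qed.

Lemma sym2Zl c x y : sym2 (c *: x) y = c ^+ 2 *: sym2 x y.
Proof. by rewrite /sym2 -!(scalerAl, scalerAr) !scalerA -!scalerDr expr2. Qed.

Lemma sym2Zr c x y : sym2 x (c *: y) = c *: sym2 x y.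
Proof. by rewrite /sym2 -!(scalerAl, scalerAr) -!scalerDr. Qed.

Lemma sym2_commute x y : x * y = y * x -> sym2 x y = 3%:R *: (x * x * y).
Proof.
move=> xy; have xyx : x * y * x = x * x * y by rewrite -mulrA -xy mulrA.
by rewrite /sym2 -xy !xyx scaler_nat !mulrS addr0 addrA.
Qed.

Variables (U : {vspace A}) (c : K).
Hypothesis U_cubes : forall x, x \in U -> is_scalar (x ^+ 3).
Hypothesis c_neq : c ^+ 2 - c != 0.

(** Expanding (x + y)^3 only gives [sym2 x y + sym2 y x].  Replacing x by c x
    multiplies the two summands by c^2 and by c, and this separates them in
    every characteristic, 2 included. *)
Lemma sym2_scalar x y : x \in U -> y \in U -> is_scalar (sym2 x y).
Proof.
move=> xU yU.
have pol u v : u \in U -> v \in U -> is_scalar (sym2 u v + sym2 v u).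
  move=> uU vU; have -> : sym2 u v + sym2 v u = (u + v) ^+ 3 - u ^+ 3 - v ^+ 3.
    by rewrite cubeD [RHS]addrAC addrK -(addrA (u ^+ 3)) [RHS]addrAC subrr add0r.
  by apply: scalarB; [apply: scalarB|]; apply: U_cubes; rewrite ?memvD.
have -> : sym2 x y = (c ^+ 2 - c)^-1 *:
    (sym2 (c *: x) y + sym2 y (c *: x) - c *: (sym2 x y + sym2 y x)).
  rewrite sym2Zl sym2Zr (scalerDr c (sym2 x y)) opprD addrACA subrr addr0.
  by rewrite -scalerBl scalerA mulVf // scale1r.
apply: scalarZ; apply: scalarB; last by apply/scalarZ/pol.
by apply: pol; rewrite ?memvZ.
Qed.

Lemma sym3_scalar x y z :
  x \in U -> y \in U -> z \in U -> is_scalar (sym3 x y z).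
Proof.
move=> xU yU zU.
have -> : sym3 x y z = sym2 (x + y) z - (sym2 x z + sym2 y z).
  by rewrite sym2Dl addrC addKr.
by apply: scalarB; [|apply: scalarD]; apply: sym2_scalar; rewrite ?memvD.
Qed.

End Polarisation.

(** * Monomials of a quantum torus *)
Section QuantumTorus.
Variables (F : fieldType) (N : nat) (rho : F) (K : fieldType).
Variable toK : {rmorphism {mpoly F[N]} -> K}.
Hypothesis rho_prim : 3.-primitive_root rho.
Hypothesis toK_inj : injective toK.
Variables (A : falgType K) (J : 'M['F_3]_N) (Z : 'I_N -> A).
Hypothesis J_skew : J^T = - J.

Definition constK (c : F) : K := toK c%:MP.
Local Notation r := (constK rho).
Local Notation chi := (chi r).
Local Notation w := (skew_form J).

Hypothesis Z_cube : forall i, Z i ^+ 3 = (toK 'X_i)%:A.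
Hypothesis Z_comm : forall i j, Z i * Z j = chi (J i j) *: (Z j * Z i).

Implicit Types (m : 'X_{1..N}) (a b : 'rV['F_3]_N) (x y z : A).

Lemma constKM c d : constK (c * d) = constK c * constK d.
Proof. by rewrite /constK mpolyCM rmorphM. Qed.

Lemma constKN c : constK (- c) = - constK c.
Proof. by rewrite /constK mpolyCN rmorphN. Qed.

Lemma constK_nat n : constK n%:R = n%:R.
Proof. by rewrite /constK mpolyC_nat rmorph_nat. Qed.

Lemma constK_prim : 3.-primitive_root r.
Proof.
pose f : {rmorphism F -> K} := toK \o @mpolyC N F.
by rewrite -[r]/(f rho) fmorph_primitive_root.
Qed.
Local Notation rP := constK_prim.

Definition qmon m : A := mmap1 Z m.

(** The class of an exponent modulo 3.  It determines the line over K that the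
    monomial spans, and its commutation with the other monomials. *)
Definition mclass m : 'rV['F_3]_N := \row_i (m i)%:R.

Definition class_repr a : 'X_{1..N} := [multinom (a ord0 i : nat) | i < N].

Lemma class_reprK a : mclass (class_repr a) = a.
Proof. by apply/rowP => i; rewrite mxE mnmE natr_Zp. Qed.

Lemma mclassD m m' : mclass (m + m')%MM = mclass m + mclass m'.
Proof. by apply/rowP => i; rewrite !mxE mnmDE natrD. Qed.

Definition qcomm t x y := x * y = chi t *: (y * x).

Lemma qcommM s t x y z : qcomm s x y -> qcomm t x z -> qcomm (s + t) x (y * z).
Proof.
rewrite /qcomm => xy xz; rewrite mulrA xy -scalerAl -[y * x * z]mulrA xz.
by rewrite -scalerAr scalerA -(chiD rP) mulrA.
Qed.

Lemma qcomm1 x : qcomm 0 x 1.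
Proof. by rewrite /qcomm chi0 scale1r mulr1 mul1r. Qed.

Lemma qcommX t x y n : qcomm t x y -> qcomm (t *+ n) x (y ^+ n).
Proof.
move=> xy; elim: n => [|n IHn]; first exact: qcomm1.
by rewrite mulrS exprS; apply: qcommM.
Qed.

Lemma qcomm_prod (I : Type) (l : seq I) (t : I -> 'F_3) x (y : I -> A) :
    (forall i, qcomm (t i) x (y i)) ->
  qcomm (\sum_(i <- l) t i) x (\prod_(i <- l) y i).
Proof.
move=> xy; apply: (big_ind2 (fun s z => qcomm s x z)) => //.
- exact: qcomm1.
- by move=> s y1 s' y2; apply: qcommM.
Qed.

Lemma qcommC t x y : qcomm t x y -> qcomm (- t) y x.
Proof.
rewrite /qcomm => ->; rewrite scalerA -(chiD rP).
by rewrite addNr chi0 scale1r.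
Qed.

(** Moving generators past each other one at a time adds up the exponents
    [J i j], with the multiplicities [m i] and [m' j]. *)
Lemma qmon_qcomm m m' : qcomm (w (mclass m) (mclass m')) (qmon m) (qmon m').
Proof.
have gen i : qcomm (\sum_j (J i j *+ m' j)) (Z i) (qmon m').
  by apply: qcomm_prod => j; apply/qcommX/Z_comm.
have -> : w (mclass m) (mclass m') = - \sum_i (- (\sum_j (J i j *+ m' j)) *+ m i).
  rewrite -sumrN /skew_form -mulmxA mxE; apply: eq_bigr => i _.
  rewrite mulNrn opprK !mxE mulr_natl; congr (_ *+ _).
  by apply: eq_bigr => j _; rewrite !mxE mulr_natr.
by apply/qcommC/qcomm_prod => i; apply/qcommX/qcommC/gen.
Qed.

(** Only the fact that a product of monomials is again a monomial up to a power
    of rho matters later, not the power itself.  Modulo these powers all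
    monomials commute. *)
Definition qeq x y := exists k : nat, x = r ^+ k *: y.

Lemma qeq_refl x : qeq x x. Proof. by exists 0%N; rewrite scale1r. Qed.

Lemma qeq_trans y x z : qeq x y -> qeq y z -> qeq x z.
Proof. by case=> k -> [l ->]; exists (k + l)%N; rewrite scalerA exprD. Qed.

Lemma qeqM x x' y y' : qeq x x' -> qeq y y' -> qeq (x * y) (x' * y').
Proof.
case=> k -> [l ->]; exists (k + l)%N.
by rewrite -scalerAl -scalerAr scalerA exprD.
Qed.

Lemma qcomm_qeq t x y : qcomm t x y -> qeq (x * y) (y * x).
Proof. by exists t. Qed.

Lemma qmon_mul m m' : qeq (qmon m * qmon m') (qmon (m + m')%MM).
Proof.
rewrite /qmon /mmap1.
under [X in qeq _ X]eq_bigr do rewrite mnmDE exprD.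
elim: (index_enum _) => [|i l IHl].
  by rewrite !big_nil mulr1; apply: qeq_refl.
rewrite !big_cons; apply: qeq_trans (qeqM (qeq_refl _) IHl).
rewrite -!mulrA; apply: qeqM; first exact: qeq_refl.
rewrite !mulrA; apply: qeqM; last exact: qeq_refl.
apply: (@qcomm_qeq (- \sum_(j <- l) (J i j *+ m' i *+ m j))).
apply/qcommC/qcomm_prod => j; apply: qcommX.
by rewrite -[_ *+ m' i]opprK -mulNrn; apply/qcommC/qcommX/qcommC/Z_comm.
Qed.

Definition quo_mon m : 'X_{1..N} := [multinom (m i %/ 3)%N | i < N].

Lemma quo_monK m : (quo_mon m *+ 3 + class_repr (mclass m))%MM = m.
Proof.
apply/mnmP => i; rewrite mnmDE mulmnE !mnmE mxE val_Fp_nat //.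
exact/esym/divn_eq.
Qed.

Lemma quo_mon_inj m m' : mclass m = mclass m' -> quo_mon m = quo_mon m' -> m = m'.
Proof. by move=> cE qE; rewrite -[m]quo_monK -[m']quo_monK cE qE. Qed.

(** The cubes of the generators are the indeterminates, and they are at the left
    of the powers of the same generator: no reordering is involved. *)
Lemma qmon_cube m m' : qmon (m' *+ 3 + m)%MM = toK 'X_[m'] *: qmon m.
Proof.
rewrite mpolyXE_id rmorph_prod /= /qmon /mmap1 -scaler_prod.
apply: eq_bigr => i _; rewrite mnmDE mulmnE exprD mulnC exprM Z_cube.
by rewrite rmorphXn /= exprZn expr1n -scalerAl mul1r.
Qed.

Lemma qmon_split m : qmon m = toK 'X_[quo_mon m] *: qmon (class_repr (mclass m)).
Proof. by rewrite -qmon_cube quo_monK. Qed.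

Lemma Z_unit i : Z i \is a GRing.unit.
Proof.
have nz : toK 'X_i != 0.
  rewrite -(rmorph0 toK) (inj_eq toK_inj).
  by apply/eqP => /(congr1 (mcoeff U_(i))) /eqP; rewrite mcoeffX eqxx mcoeff0 oner_eq0.
apply/unitrP; exists ((toK 'X_i)^-1 *: Z i ^+ 2).
by rewrite -scalerAl -scalerAr -exprS -exprSr Z_cube scalerA mulVf // scale1r.
Qed.

Lemma qmon_unit m : qmon m \is a GRing.unit.
Proof.
apply: (big_ind (fun x => x \is a GRing.unit)) => [|x y ux uy|i _].
- exact: unitr1.
- by rewrite unitrMr.
- by rewrite unitrX // Z_unit.
Qed.

Lemma qmon_neq0 m : qmon m != 0.
Proof. by apply: contraTneq (qmon_unit m) => ->; rewrite unitr0. Qed.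

Hypothesis J_unit : J \in unitmx.

(** Orthogonality of characters: [chi (w b a)] is, as a function of b, a
    character of F_3^N, which is nontrivial for a <> 0 as the form is
    nondegenerate. *)
Lemma sum_chi_skew_form a :
  \sum_b chi (w b a) = if a == 0 then (3 ^ N)%:R else 0.
Proof.
have [->|a_nz] := eqVneq a 0.
  under eq_bigr do rewrite /skew_form trmx0 mulmx0 mxE chi0.
  by rewrite sumr_const card_mx card_Fp // mul1n.
have [b0 b0a] : exists b0, w b0 a != 0.
  have : J *m a^T != 0.
    apply: contraNneq a_nz => Ja; rewrite -[a]trmxK -[a^T](mulKmx J_unit) Ja.
    by rewrite mulmx0 trmx0.
  case/matrix0Pn=> i [j Jai]; exists (delta_mx 0 i).
  by rewrite /skew_form -mulmxA -rowE mxE -(ord1 j).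
have : (chi (w b0 a) - 1) * (\sum_b chi (w b a)) = 0.
  rewrite mulrBl mul1r mulr_sumr [X in _ - X](reindex_inj (addrI b0)) /= -sumrB.
  by apply: big1 => b _; rewrite skew_formDl (chiD rP) subrr.
by move/eqP; rewrite mulf_eq0 subr_eq0 (chi_eq1 rP) (negPf b0a) => /eqP.
Qed.

Definition class_mon a := qmon (class_repr a).

(** Conjugation by the monomial of class b multiplies a monomial of class c by
    [chi (w b c)].  By orthogonality of characters this average is the projection
    on the monomials of class a that kills the other classes.  It also proves
    their independence, without a basis of the algebra. *)
Definition class_proj a : 'End(A) :=
  (3 ^ N)%:R^-1 *: \sum_b
    chi (- w b a) *: (amull (class_mon b) \o amulr (class_mon b)^-1%R)%VF.

Lemma class_proj_qmon a m : class_proj a (qmon m) = (mclass m == a)%:R *: qmon m.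
Proof.
rewrite /class_proj scale_lfunE sum_lfunE.
have conj b : chi (- w b a) *: (class_mon b * (qmon m * (class_mon b)^-1))
               = chi (w b (mclass m - a)) *: qmon m.
  have := qmon_qcomm (class_repr b) m; rewrite /qcomm class_reprK mulrA.
  rewrite /class_mon => ->.
  rewrite -scalerAl mulrK ?qmon_unit // scalerA -(chiD rP).
  by rewrite skew_formDr skew_formNr addrC.
under eq_bigr do rewrite scale_lfunE comp_lfunE !lfunE /= ?lfunE /= conj.
rewrite -scaler_suml sum_chi_skew_form subr_eq0 scalerA.
case: eqP => _; last by rewrite mulr0.
by rewrite mulVf // natrX expf_neq0 // (three_neq0 rP).
Qed.

(** The additive map that substitutes Z_i for the i-th indeterminate and writes
    the generators of a monomial in increasing order.  It is not multiplicative,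
    but it carries the supports and leading terms of polynomials to A. *)
Definition qeval (p : {mpoly F[N]}) : A :=
  mmap (in_alg A \o toK \o @mpolyC N F) Z p.

Lemma qevalE p : qeval p = \sum_(m <- msupp p) constK p@_m *: qmon m.
Proof. by apply: eq_bigr => m _; rewrite /= mulr_algl. Qed.

Lemma qevalD p q : qeval (p + q) = qeval p + qeval q.
Proof. exact: mmapD. Qed.

Lemma qevalN p : qeval (- p) = - qeval p.
Proof. exact: mmapN. Qed.

Lemma qeval0 : qeval 0 = 0.
Proof. exact: mmap0. Qed.

Lemma qevalZX c m : qeval (c *: 'X_[m]) = constK c *: qmon m.
Proof. by rewrite /qeval mmapZ mmapX /= mulr_algl. Qed.

Lemma qevalX m : qeval 'X_[m] = qmon m.
Proof. exact: mmapX. Qed.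

(** The monomials of one class are the multiples of a single unit of A by
    pairwise different monomials in the indeterminates, which are independent
    over F. *)
Lemma class_proj_qeval_eq0 p m : class_proj (mclass m) (qeval p) = 0 -> p@_m = 0.
Proof.
pose f := \sum_(m' <- msupp p | mclass m' == mclass m) p@_m' *: 'X_[quo_mon m'].
have -> : class_proj (mclass m) (qeval p) = toK f *: class_mon (mclass m).
  rewrite qevalE linear_sum rmorph_sum scaler_suml [RHS]big_mkcond /=.
  apply: eq_bigr => m' _; rewrite linearZ /= class_proj_qmon.
  case: eqP => [E|_]; last by rewrite scale0r scaler0.
  by rewrite scale1r qmon_split E -mul_mpolyC rmorphM scalerA.
move/eqP; rewrite scaler_eq0 (negPf (qmon_neq0 _)) orbF -(rmorph0 toK).
move/eqP/toK_inj/(congr1 (mcoeff (quo_mon m))).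
rewrite mcoeff0 raddf_sum /= => <-.
have [mp|mp] := boolP (m \in msupp p).
  rewrite (big_rem m) //= eqxx mcoeffZ mcoeffX eqxx mulr1 big_seq_cond big1 ?addr0 //.
  move=> m' /andP[m'p /eqP E]; rewrite mcoeffZ mcoeffX.
  case: eqP => [/(quo_mon_inj E) m'm|]; last by rewrite mulr0.
  by move: m'p; rewrite m'm mem_rem_uniqF // msupp_uniq.
rewrite (memN_msupp_eq0 mp) big_seq_cond big1 // => m' /andP[m'p /eqP E].
rewrite mcoeffZ mcoeffX; case: eqP => [/(quo_mon_inj E) m'm|]; last by rewrite mulr0.
by rewrite m'm (negPf mp) in m'p.
Qed.

(** The F-span of the monomials with exponents in P. *)
Definition supported (P : pred 'X_{1..N}) x :=
  exists2 p, x = qeval p & {subset msupp p <= P}.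

Lemma supported_qmon (P : pred 'X_{1..N}) c m : P m -> supported P (constK c *: qmon m).
Proof.
move=> Pm; exists (c *: 'X_[m]); first by rewrite qevalZX.
by move=> m' /msuppZ_le; rewrite msuppX inE => /eqP->.
Qed.

Lemma supportedD P x y : supported P x -> supported P y -> supported P (x + y).
Proof.
case=> p -> pP [q -> qP]; exists (p + q); first by rewrite qevalD.
by move=> m /msuppD_le; rewrite mem_cat => /orP[/pP|/qP].
Qed.

Lemma supported0 P : supported P 0.
Proof. by exists 0; rewrite ?qeval0 // => m; rewrite msupp0. Qed.

Lemma supported_sum P (I : eqType) (l : seq I) (x : I -> A) :
  (forall i, i \in l -> supported P (x i)) -> supported P (\sum_(i <- l) x i).
Proof.
move=> xP; rewrite big_seq; apply: (big_ind (supported P)) => //.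
- exact: supported0.
- exact: supportedD.
Qed.

Lemma supportedM (P Q S : pred 'X_{1..N}) x y :
    (forall m m', P m -> Q m' -> S (m + m')%MM) ->
  supported P x -> supported Q y -> supported S (x * y).
Proof.
move=> PQS [p -> pP] [q -> qQ]; rewrite !qevalE mulr_suml.
apply: supported_sum => m /pP Pm; rewrite mulr_sumr.
apply: supported_sum => m' /qQ Qm'.
have [k E] := qmon_mul m m'.
rewrite -scalerAl -scalerAr E !scalerA.
have -> : constK p@_m * constK q@_m' * r ^+ k = constK (p@_m * q@_m' * rho ^+ k).
  by rewrite /constK !rmorphM !rmorphXn.
by apply: supported_qmon; apply: PQS.
Qed.

Hypothesis Z_gen : agenv <<codom Z>>%VS = fullv.
Hypothesis toK_frac : forall c : K,
  exists d f : {mpoly F[N]}, d != 0 /\ c * toK d = toK f.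

Lemma qmon_in_span m : qmon m \in (\sum_a <[class_mon a]>)%VS.
Proof.
rewrite qmon_split memvZ //.
by rewrite memvE (sumv_sup (mclass m)).
Qed.

(** The span contains 1 and is stable under left multiplication by the
    generators, so it contains the subalgebra that they generate. *)
Lemma class_mon_span : (\sum_a <[class_mon a]>)%VS = fullv.
Proof.
apply/eqP; rewrite eqEsubv subvf -Z_gen; apply: agenv_sub_modl.
  by rewrite -memvE -[1](mmap11 Z) qmon_in_span.
rewrite big_distrr /=; apply/subv_sumP => a _.
rewrite -limg_amulr limg_span; apply/span_subvP => _ /mapP[_ /codomP[i ->] ->].
rewrite lfunE /= -[Z i](mmap1U Z); have [k ->] := qmon_mul U_(i) (class_repr a).
by rewrite memvZ // qmon_in_span.
Qed.

Lemma toK_scale_qeval d p : exists q, toK d *: qeval p = qeval q.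
Proof.
suff [q -> _] : supported predT (toK d *: qeval p) by exists q.
rewrite qevalE scaler_sumr; apply: supported_sum => m _.
rewrite {1}[d]mpolyE rmorph_sum scaler_suml; apply: supported_sum => m' _.
rewrite -mul_mpolyC rmorphM scalerA mulrAC -scalerA -qmon_cube.
by rewrite -!rmorphM; apply: supported_qmon.
Qed.

Lemma toK_eq0 d : (toK d == 0) = (d == 0).
Proof. by rewrite -(rmorph0 toK) (inj_eq toK_inj). Qed.

(** Expand in the spanning monomials and multiply by a common denominator of the
    coefficients. *)
Lemma clear_denominators x :
  exists d p : {mpoly F[N]}, d != 0 /\ toK d *: x = qeval p.
Proof.
have /memv_sumP[v vP ->] : x \in (\sum_a <[class_mon a]>)%VS.
  by rewrite class_mon_span memvf.
pose good y := exists d p : {mpoly F[N]}, d != 0 /\ toK d *: y = qeval p.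
apply: (big_rec good) => [|a y _].
  by exists 1, 0; rewrite oner_eq0 scaler0 qeval0.
case=> d [p [d0 E]]; have /vlineP[c ->] := vP a isT.
have [d' [f [d'0 E']]] := toK_frac c.
have [q qE] := toK_scale_qeval d' p.
have [q' q'E] := toK_scale_qeval (d * f) 'X_[class_repr a].
exists (d * d'), (q' + q); split; first by rewrite mulf_neq0.
rewrite qevalD -qE -q'E -E scalerDr !rmorphM /= !scalerA -E'; congr (_ + _).
  by rewrite qevalX; congr (_ *: _); ring.
by rewrite mulrC.
Qed.

Lemma class_proj_line a x : class_proj a x \in <[class_mon a]>%VS.
Proof.
have /memv_sumP[v vP ->] : x \in (\sum_b <[class_mon b]>)%VS.
  by rewrite class_mon_span memvf.
rewrite linear_sum memv_suml //= => b _; have /vlineP[c ->] := vP b isT.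
rewrite linearZ /= class_proj_qmon class_reprK.
case: eqP => [->|_]; first by rewrite !memvZ ?memv_line.
by rewrite scale0r scaler0 mem0v.
Qed.

(** Gaussian elimination.  Take a nonzero element of U, with leading class a.
    The elements of U that [class_proj a] kills form a hyperplane of U, and
    none of them has leading class a; so induction on this hyperplane gives the
    remaining classes. *)
Lemma leading_classes (U : {vspace A}) : exists2 T : {set 'rV['F_3]_N},
  (\dim U <= #|T|)%N & forall a, a \in T ->
    exists p : {mpoly F[N]}, [/\ p != 0, qeval p \in U & mclass (mlead p) = a].
Proof.
move: {2}(\dim U) (leqnn (\dim U)) => k; elim: k U => [|k IHk] U dU.
  by exists set0 => [|a]; rewrite ?cards0 // inE.
have [U0|U0] := eqVneq U 0%VS.
  by exists set0 => [|a]; rewrite ?cards0 ?U0 ?dimv0 // inE.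
have [d [p [d0 pE]]] := clear_denominators (vpick U).
have dx_nz : toK d *: vpick U != 0.
  by rewrite scaler_eq0 toK_eq0 negb_or d0 vpick0.
have p0 : p != 0 by apply: contraNneq dx_nz => p0; rewrite pE p0 qeval0.
set a := mclass (mlead p).
have pU : qeval p \in U by rewrite -pE memvZ // memv_pick.
have dker := limg_ker_dim (class_proj a) U.
have dimg : \dim (class_proj a @: U) = 1%N.
  apply/eqP; rewrite eqn_leq; apply/andP; split.
    rewrite -[1%N]/(true : nat) -(qmon_neq0 (class_repr a)) -dim_vline dimvS //.
    by apply/subvP => _ /memv_imgP[x _ ->]; apply: class_proj_line.
  rewrite lt0n dimv_eq0; apply: contraNneq p0 => img0.
  rewrite -mleadc_eq0; apply/eqP/class_proj_qeval_eq0/eqP.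
  by rewrite -memv0 -img0 memv_img.
have [|T dT TP] := IHk (U :&: lker (class_proj a))%VS.
  by rewrite -ltnS -addn1 -dimg dker.
exists (a |: T) => [|b].
  rewrite cardsU1 -dker dimg addnC leq_add //.
  have [/TP[q [q0]]|//] := boolP (a \in T).
  rewrite memv_cap memv_ker => /andP[_ /eqP qa] qE.
  by move: q0; rewrite -mleadc_eq0 (class_proj_qeval_eq0 (m := mlead q)) ?eqxx ?qE.
case/setU1P=> [->|/TP[q [q0 qU qb]]]; first by exists p.
by exists q; split=> //; move: qU; rewrite memv_cap => /andP[].
Qed.

(** Both elements have exponents at most m and the same coefficient at m.  This
    congruence also covers sums in which the terms at m may cancel. *)
Definition same_lead m x y :=
  [/\ supported (fun m' => m' <= m)%O x, supported (fun m' => m' <= m)%O y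
    & supported (fun m' => m' < m)%O (x - y)].

Lemma same_leadD m x x' y y' :
  same_lead m x y -> same_lead m x' y' -> same_lead m (x + x') (y + y').
Proof.
case=> xm ym xy [x'm y'm xy']; split; try exact: supportedD.
by rewrite opprD addrACA; apply: supportedD.
Qed.

Lemma same_leadM m m' x x' y y' :
    same_lead m x y -> same_lead m' x' y' ->
  same_lead (m + m')%MM (x * x') (y * y').
Proof.
case=> xm ym xy [x'm y'm xy']; split.
- by apply: supportedM xm x'm => k k'; apply: lem_add.
- by apply: supportedM ym y'm => k k'; apply: lem_add.
have -> : x * x' - y * y' = (x - y) * x' + y * (x' - y').
  by rewrite mulrBl mulrBr addrA subrK.
apply: supportedD.
  by apply: supportedM xy x'm => k k'; apply: ltmc_le_add.
by apply: supportedM ym xy' => k k'; apply: lemc_lt_add.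
Qed.

Lemma qeval_same_lead p :
  same_lead (mlead p) (qeval p) (constK (mleadc p) *: qmon (mlead p)).
Proof.
have pm : supported (fun m' => m' <= mlead p)%O (qeval p).
  by exists p => // m /msupp_le_mlead.
split=> //; first exact: supported_qmon.
exists (p - mleadc p *: 'X_[mlead p]); first by rewrite qevalD qevalN qevalZX.
move=> m mp; rewrite unfold_in /= lt_neqAle.
have [mE|_] /= := eqVneq m (mlead p).
  by move: mp; rewrite mcoeff_msupp mcoeffB mcoeffZ mcoeffX mE eqxx mulr1 subrr eqxx.
have := msuppB_le mp; rewrite mem_cat => /orP[/msupp_le_mlead//|].
by move/msuppZ_le; rewrite msuppX inE => /eqP->.
Qed.

(** A scalar only has monomials of class 0. *)
Lemma scalar_same_lead m x c :
    is_scalar x -> same_lead m x (constK c *: qmon m) -> c != 0 -> mclass m = 0.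
Proof.
case=> k xE [_ _ [p pE pm]] c0; apply/eqP; apply: contraNT c0 => mclassm.
have xE' : x = qeval (c *: 'X_[m] + p) by rewrite qevalD qevalZX -pE addrC subrK.
have : class_proj (mclass m) x = 0.
  rewrite xE linearZ /= -[1](mmap11 Z) -/(qmon _) class_proj_qmon.
  have -> : mclass 0%MM = 0 by apply/rowP => i; rewrite !mxE mnm0E.
  by rewrite eq_sym (negPf mclassm) scale0r scaler0.
rewrite xE' => /class_proj_qeval_eq0; rewrite mcoeffD mcoeffZ mcoeffX eqxx mulr1.
rewrite memN_msupp_eq0 ?addr0 => [->|] //.
by apply/negP => /pm; rewrite unfold_in /= ltxx.
Qed.

(** In a cyclic triangle the even orders of the product all equal xyz and the odd
    ones r^2 xyz, so that the sum is 3(1 + r^2) xyz.  (For a transitive triple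
    it would be 2(1 + r + r^2) xyz = 0.) *)
Lemma sym3_cyclic (x y z : A) :
    qcomm 1 x y -> qcomm 1 y z -> qcomm 1 z x ->
  sym3 x y z = (- 3%:R * r) *: (x * y * z).
Proof.
move=> xy yz zx.
have yzx : y * z * x = x * y * z.
  have := qcommM xy (qcommC zx).
  by rewrite /qcomm subrr chi0 scale1r mulrA => ->.
have zxy : z * x * y = x * y * z.
  have := qcommM zx (qcommC yz).
  by rewrite /qcomm subrr chi0 scale1r mulrA => ->.
have chiN1 : chi (- 1) = r ^+ 2 by [].
have yx : y * x = r ^+ 2 *: (x * y) by rewrite -chiN1; apply: (qcommC xy).
have zy : z * y = r ^+ 2 *: (y * z) by rewrite -chiN1; apply: (qcommC yz).
rewrite /sym3 yzx zxy yx -[x * z * y]mulrA zy -!(scalerAl, scalerAr) !mulrA yzx.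
rewrite -{1 2 3}[x * y * z]scale1r -!scalerDl; congr (_ *: _).
have /eqP := sum_cube_roots rP; rewrite addrC addr_eq0 => /eqP ->; ring.
Qed.

(** * Spaces of elements with scalar cubes *)
Variable U : {vspace A}.
Hypothesis U_cubes : forall x, x \in U -> is_scalar (x ^+ 3).

Lemma r_square_neq : r ^+ 2 - r != 0.
Proof.
rewrite expr2 -{3}[r]mulr1 -mulrBr mulf_neq0 //.
  by have := chi_neq0 rP 1; rewrite chi1.
by rewrite subr_eq0 -[r]chi1 (chi_eq1 rP).
Qed.

Definition lead_term p := constK (mleadc p) *: qmon (mlead p).

Lemma lead_term_qcomm p q :
  qcomm (w (mclass (mlead p)) (mclass (mlead q))) (lead_term p) (lead_term q).
Proof.
have := qmon_qcomm (mlead p) (mlead q).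
rewrite /qcomm /lead_term -!(scalerAl, scalerAr) => ->.
by rewrite !scalerA; congr (_ *: _); ring.
Qed.

Lemma lead_termM3 p q s : exists k : nat, lead_term p * lead_term q * lead_term s
  = constK (mleadc p * mleadc q * mleadc s * rho ^+ k)
    *: qmon (mlead p + mlead q + mlead s)%MM.
Proof.
have [k kE] := qmon_mul (mlead p) (mlead q).
have [l lE] := qmon_mul (mlead p + mlead q)%MM (mlead s).
exists (k + l)%N; rewrite /lead_term -!(scalerAl, scalerAr) kE.
rewrite -!(scalerAl, scalerAr) lE.
rewrite !scalerA; congr (_ *: _).
by rewrite /constK !rmorphM !rmorphXn /= exprD; ring.
Qed.

(** If the leading terms x of [qeval p] and y of [qeval q] commute, the scalar
    [sym2 (qeval p) (qeval q)] has the leading term 3xxy, so that 2a + b = 0 for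
    their classes a and b; modulo 3 this says a = b. *)
Lemma leading_classes_noncommuting p q :
    qeval p \in U -> qeval q \in U -> p != 0 -> q != 0 ->
    mclass (mlead p) != mclass (mlead q) ->
  w (mclass (mlead p)) (mclass (mlead q)) != 0.
Proof.
move=> pU qU p0 q0; apply: contraNneq => wpq.
have pq := lead_term_qcomm p q; rewrite wpq /qcomm chi0 scale1r in pq.
have lp := qeval_same_lead p; have lq := qeval_same_lead q.
have L : same_lead (mlead p + mlead p + mlead q)%MM (sym2 (qeval p) (qeval q))
            (sym2 (lead_term p) (lead_term q)).
  apply: same_leadD; first apply: same_leadD.
  - by apply: same_leadM => //; apply: same_leadM.
  - rewrite -addmA [(mlead p + mlead q)%MM]addmC addmA.
    by apply: same_leadM => //; apply: same_leadM.
  - by rewrite addmC addmA; apply: same_leadM => //; apply: same_leadM.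
have [k E] := lead_termM3 p p q.
have {}E : sym2 (lead_term p) (lead_term q)
    = constK (3%:R * (mleadc p * mleadc p * mleadc q * rho ^+ k))
      *: qmon (mlead p + mlead p + mlead q)%MM.
  by rewrite sym2_commute // E scalerA (constKM 3%:R) constK_nat.
rewrite E in L.
have mclassE := scalar_same_lead (sym2_scalar U_cubes r_square_neq pU qU) L.
have /mclassE : 3%:R * (mleadc p * mleadc p * mleadc q * rho ^+ k) != 0.
  rewrite !mulf_neq0 ?mleadc_eq0 ?expf_neq0 ?(three_neq0 rho_prim) //.
  by have := chi_neq0 rho_prim 1; rewrite chi1.
rewrite !mclassD => /eqP; rewrite addr_eq0 => /eqP E'.
apply/eqP/oppr_inj; rewrite -E'; apply/rowP => i; rewrite !mxE.
by case: (F3_cases (mlead p i)%:R) => ->; apply: val_inj.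
Qed.

(** The leading terms x, y, z now form a cyclic triangle, and the scalar [sym3]
    of the three elements has the leading term -3 rho xyz, so the class of xyz
    is zero. *)
Lemma leading_classes_cyclic p q s :
    qeval p \in U -> qeval q \in U -> qeval s \in U ->
    p != 0 -> q != 0 -> s != 0 ->
    w (mclass (mlead p)) (mclass (mlead q)) = 1 ->
    w (mclass (mlead q)) (mclass (mlead s)) = 1 ->
    w (mclass (mlead s)) (mclass (mlead p)) = 1 ->
  mclass (mlead p) + mclass (mlead q) + mclass (mlead s) = 0.
Proof.
move=> pU qU sU p0 q0 s0 wpq wqs wsp.
have := lead_term_qcomm p q; have := lead_term_qcomm q s; have := lead_term_qcomm s p.
rewrite wpq wqs wsp => sp qs pq.
have lp := qeval_same_lead p; have lq := qeval_same_lead q.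
have ls := qeval_same_lead s.
have M3 x y z x' y' z' m m' m'' : same_lead m x x' -> same_lead m' y y' ->
    same_lead m'' z z' -> (m + m' + m'' = mlead p + mlead q + mlead s)%MM ->
  same_lead (mlead p + mlead q + mlead s)%MM (x * y * z) (x' * y' * z').
  move=> Lx Ly Lz <-.
  by apply: same_leadM => //; apply: same_leadM.
have L : same_lead (mlead p + mlead q + mlead s)%MM
    (sym3 (qeval p) (qeval q) (qeval s))
    (sym3 (lead_term p) (lead_term q) (lead_term s)).
  by do !apply: same_leadD; [apply: M3 lp lq ls _ | apply: M3 lq ls lp _
    | apply: M3 ls lp lq _ | apply: M3 lq lp ls _ | apply: M3 lp ls lq _
    | apply: M3 ls lq lp _]; apply/mnmP => i; rewrite !mnmDE; lia.
have [k E] := lead_termM3 p q s.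
have {}E : sym3 (lead_term p) (lead_term q) (lead_term s)
    = constK (- 3%:R * rho * (mleadc p * mleadc q * mleadc s * rho ^+ k))
      *: qmon (mlead p + mlead q + mlead s)%MM.
  rewrite (sym3_cyclic pq qs sp) E scalerA.
  by rewrite (constKM (- 3%:R * rho)) (constKM (- 3%:R)) constKN constK_nat.
rewrite E in L; rewrite -!mclassD.
apply: (scalar_same_lead (sym3_scalar U_cubes r_square_neq pU qU sU) L).
have rho0 : rho != 0 by have := chi_neq0 rho_prim 1; rewrite chi1.
by rewrite !mulf_neq0 ?mleadc_eq0 ?expf_neq0 ?oppr_eq0 ?(three_neq0 rho_prim).
Qed.

Lemma dim_scalar_cube_space : (\dim U <= N.+1 + N.+1./2)%N.
Proof.
have [T dT TP] := leading_classes U.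
apply: leq_trans dT _; apply: (card_triangle_condition J_skew).
  move=> _ _ /TP[p [p0 pU <-]] /TP[q [q0 qU <-]].
  exact: leading_classes_noncommuting.
move=> _ _ _ /TP[p [p0 pU <-]] /TP[q [q0 qU <-]] /TP[s [s0 sU <-]].
exact: leading_classes_cyclic.
Qed.
End QuantumTorus.

(** * Tensor products of symbol algebras *)
Lemma fraction_denominator (R : idomainType) (c : {fraction R}) :
  exists d f : R, d != 0 /\ c * tofrac d = tofrac f.
Proof.
exists \d_(repr c), \n_(repr c); split; first exact: denom_ratioP.
have d0 := denom_ratioP (repr c).
rewrite -[X in X * _]reprK; unlock FracField.tofrac.
rewrite -[LHS]FracField.pi_mul; apply/eqmodP => /=.
rewrite /FracField.equivf /FracField.mulf /=.
by rewrite !numden_Ratio ?oner_eq0 ?mulr1 // mulrC.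
Qed.

Section SubalgebraInclusion.
Variables (K : fieldType) (A : falgType K) (U : {vspace A}).

(** A synonym of [vsval] to carry the algebra morphism structure: the
    inclusion of a subalgebra preserves 1 only when the subalgebra contains it,
    as those of the form [agenv U] do. *)
Definition agenv_val (u : subvs_of <<U>>%AS) : A := vsval u.

Lemma agenv_val_is_linear : linear agenv_val.
Proof. exact: linearP. Qed.

Lemma agenv_val_is_monoid_morphism : monoid_morphism agenv_val.
Proof.
by split=> //; apply/eqP; rewrite algid_eq1 memvE sub1_agenv.
Qed.

HB.instance Definition _ := GRing.isLinear.Build K (subvs_of <<U>>%AS) A _
  agenv_val agenv_val_is_linear.
HB.instance Definition _ := GRing.isMonoidMorphism.Build (subvs_of <<U>>%AS) A
  agenv_val agenv_val_is_monoid_morphism.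

End SubalgebraInclusion.

Section TensorOfSymbols.
Variables (K : fieldType) (n : nat) (rho : K) (a b : 'I_n -> K).
Variables (S : 'I_n -> algType K) (x y : forall k, S k).
Hypothesis S_symbol : forall k, is_symbol_algebra rho (a k) (b k) (x k) (y k).
Variables (A : falgType K) (iota : forall k, {lrmorphism S k -> A}).
Hypothesis A_tensor : is_tensor_product iota.

Definition symbol_generator (i : 'I_(n + n)) : A :=
  match split i with inl k => iota k (x k) | inr k => iota k (y k) end.
Local Notation Z := symbol_generator.

Lemma symbol_generator_l k : Z (lshift n k) = iota k (x k).
Proof. by rewrite /Z (unsplitK (inl k)). Qed.

Lemma symbol_generator_r k : Z (rshift n k) = iota k (y k).
Proof. by rewrite /Z (unsplitK (inr k)). Qed.

Lemma image_relations k :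
  symbol_relations rho (a k) (b k) (iota k (x k)) (iota k (y k)).
Proof.
have [x3 y3 yx] := symbol_rel (S_symbol k).
split.
- have -> : iota k (x k) ^+ 3 = iota k (x k ^+ 3) by rewrite rmorphXn.
  by rewrite x3 rmorph_alg.
- have -> : iota k (y k) ^+ 3 = iota k (y k ^+ 3) by rewrite rmorphXn.
  by rewrite y3 rmorph_alg.
- have -> : iota k (y k) * iota k (x k) = iota k (y k * x k) by rewrite rmorphM.
  by rewrite yx linearZ /= rmorphM.
Qed.

(** Let D be the subalgebra that the images of the x_k and y_k generate.  The
    universal properties of the S_k and of A give a morphism from A to D that
    maps these images to themselves.  Followed by the inclusion of D in A it is
    the identity, by the uniqueness parts, so D is A. *)
Lemma tensor_of_symbols_generated : agenv <<codom Z>>%VS = fullv.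
Proof.
set D := <<codom Z>>%VS.
have ZD i : Z i \in agenv D.
  by rewrite (subvP (sub_agenv D)) // memv_span // codom_f.
have xD k : iota k (x k) \in agenv D by rewrite -symbol_generator_l.
have yD k : iota k (y k) \in agenv D by rewrite -symbol_generator_r.
pose B : falgType K := subvs_of <<D>>%AS.
have v_inj : injective (@agenv_val K A D) by apply: val_inj.
pose X k : B := Subvs (xD k); pose Y k : B := Subvs (yD k).
have XY k : symbol_relations rho (a k) (b k) (X k) (Y k).
  have [x3 y3 yx] := image_relations k.
  split; apply: v_inj.
  - by rewrite rmorphXn linearZ rmorph1 /= x3.
  - by rewrite rmorphXn linearZ rmorph1 /= y3.
  - by rewrite rmorphM linearZ rmorphM /= yx.
have [f fXY] := fin_all_exists (fun k => symbol_lift (S_symbol k) (XY k)).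
have vf k s : agenv_val (f k s) = iota k s.
  apply: (symbol_lift_unique (S_symbol k) (f := @agenv_val K A D \o f k)) => /=.
    by rewrite (fXY k).1.
  by rewrite (fXY k).2.
have [|h hE] := tensor_lift A_tensor (f := f).
  move=> i j ij s t; apply: v_inj; rewrite !rmorphM /= !vf.
  exact: (tensor_comm A_tensor ij).
apply/eqP; rewrite eqEsubv subvf; apply/subvP => z _.
have -> : z = agenv_val (h z).
  apply: (tensor_lift_unique A_tensor (g := idfun)
    (h := @agenv_val K A D \o h)) => i s /=.
  by rewrite hE vf.
exact: subvsP.
Qed.

End TensorOfSymbols.

(** The exponents of rho in the relations between the x_k, listed first, and
    the y_k: y_k x_k = rho x_k y_k, and all other pairs commute. *)
Definition symbol_commutation (n : nat) : 'M['F_3]_(n + n) :=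
  block_mx 0 (- 1%:M) 1%:M 0.

Lemma symbol_commutation_skew n : (symbol_commutation n)^T = - symbol_commutation n.
Proof.
by rewrite tr_block_mx opp_block_mx !trmx0 !oppr0 opprK linearN /= trmx1.
Qed.

Lemma symbol_commutation_unit n : symbol_commutation n \in unitmx.
Proof.
have [] // := @mulmx1_unit _ _ (symbol_commutation n) (- symbol_commutation n).
rewrite mulmxN mulmx_block opp_block_mx !(mul0mx, mulmx0, add0r, addr0).
by rewrite !mulNmx !mul1mx !opprK oppr0 -scalar_mx_block.
Qed.

Theorem corollary4p2 (F : fieldType) (rho : F) (n : nat)
    (n_ge1 : (1 <= n)%N)
    (F_infinite : infinite_type F)
    (F_char : 3%N \notin [pchar F])
    (rho_prim : 3.-primitive_root rho)
    (S : 'I_n -> algType (ratfun F n))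
    (x y : forall k : 'I_n, S k)
    (S_symbol : forall k : 'I_n,
       is_symbol_algebra (ratfun_const n rho) (alpha F k) (beta F k)
         (x k) (y k))
    (A : falgType (ratfun F n))
    (iota : forall k : 'I_n, {lrmorphism S k -> A})
    (A_tensor : is_tensor_product iota)
    (V : {vspace A})
    (V_kummer : kummer_space V) :
  (\dim V <= 3 * n + 1)%N.
Proof.
pose toK : {rmorphism {mpoly F[n + n]} -> ratfun F n} :=
  @FracField.tofrac {mpoly F[n + n]}.
have toK_inj : injective toK by move=> p q /eqP; rewrite tofrac_eq => /eqP.
pose Z := symbol_generator x y iota.
have rel := image_relations S_symbol iota.
have Z_cube i : Z i ^+ 3 = (toK 'X_i)%:A.
  have [k ->|k ->] := split_ordP i; have [x3 y3 _] := rel k.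
    by rewrite /Z symbol_generator_l x3.
  by rewrite /Z symbol_generator_r y3.
have Z_comm i j : Z i * Z j
    = chi (constK toK rho) (symbol_commutation n i j) *: (Z j * Z i).
  have rP := constK_prim toK rho_prim.
  have comm (k l : 'I_n) s t : k != l -> iota k s * iota l t = iota l t * iota k s.
    by move=> kl; apply: (tensor_comm A_tensor kl).
  have [k ->|k ->] := split_ordP i; have [l ->|l ->] := split_ordP j;
    rewrite /Z ?symbol_generator_l ?symbol_generator_r /symbol_commutation
      ?block_mxEul ?block_mxEur ?block_mxEdl ?block_mxEdr ?mxE.
  - rewrite chi0 scale1r; have [->//|/comm] := eqVneq k l; exact.
  - have [<-|kl] := eqVneq k l; last by rewrite oppr0 chi0 scale1r comm.
    have [_ _ ->] := rel k.
    rewrite scalerA -[ratfun_const n rho](chi1 (constK toK rho)) -(chiD rP).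
    by rewrite addNr chi0 scale1r.
  - have [<-|kl] := eqVneq k l; last by rewrite chi0 scale1r comm.
    by have [_ _ ->] := rel k.
  - rewrite chi0 scale1r; have [->//|/comm] := eqVneq k l; exact.
have V_cubes z : z \in V -> is_scalar (z ^+ 3).
  have [-> _|z0 zV] := eqVneq z 0; last by have [] := V_kummer z zV z0.
  by exists 0; rewrite scale0r expr0n.
have := dim_scalar_cube_space rho_prim toK_inj (symbol_commutation_skew n) Z_cube Z_comm
  (symbol_commutation_unit n) (tensor_of_symbols_generated S_symbol A_tensor)
  (@fraction_denominator _) V_cubes.
move: (\dim V) => d; lia.
Qed.
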